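(* Let $\mathbb A$ be a distributive monoidal category and let $\mathbf H\,\ulcorner\mathbb A\urcorner^{*}$ be the monoidal category of horizontal cells of its free cornering with iteration. For all objects $U,W$ of $\mathbf H\,\ulcorner\mathbb A\urcorner^{*}$: (i) $(U^\times,\Delta^\times_U,\pi_0)$ is a comonoid in $\mathbf H\,\ulcorner\mathbb A\urcorner^{*}$, where $\Delta^\times_U=(id_U)^\times_{id_{U^\times},\pi_1}:U^\times\to U^\times\otimes U^\times$. Dually, $(U^+,\nabla^+_U,\iota_0)$ is a monoid in $\mathbf H\,\ulcorner\mathbb A\urcorner^{*}$, where $\nabla^+_U=(id_U)^+_{id_{U^+},\iota_1}:U^+\otimes U^+\to U^+$. (ii) For any $h:(U;I;I;W)$, $\Delta^\times_U\mid\frac{h^\times}{h^\times}=h^\times\mid\Delta^\times_W$. Dually, $\nabla^+_U\mid h^+=\frac{h^+}{h^+}\mid\nabla^+_W$.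
   Context: Monoidal categories are strict, and composites are in diagrammatic order ($fg$ is first $f$, then $g$). A single-object double category $\mathbb D$ has a horizontal edge monoid $(\mathbb D_H,\otimes,I)$, a vertical edge monoid $(\mathbb D_V,\otimes,I)$, and for $A,B\in\mathbb D_H$, $U,W\in\mathbb D_V$ a set of cells $(U;A;B;W)$ (left; top; bottom; right boundary). For $\alpha:(U;A;B;V)$ and $\beta:(V;A';B';W)$ there is a horizontal composite $\alpha\mid\beta:(U;A\otimes A';B\otimes B';W)$; for $\alpha:(U;A;C;W)$ and $\beta:(U';C;B;W')$ a vertical composite $\frac{\alpha}{\beta}:(U\otimes U';A;B;W\otimes W')$. Both are associative and unital, with horizontal units $id_U:(U;I;I;U)$ and vertical units $1_A:(I;A;A;I)$, where $id_I=1_I$, $1_{A\otimes B}=1_A\mid 1_B$, $id_{U\otimes W}=\frac{id_U}{id_W}$, and interchange $\frac{\alpha}{\beta}\mid\frac{\gamma}{\delta}=\frac{\alpha\mid\gamma}{\beta\mid\delta}$ holds. $\mathbf H\,\mathbb D$ is the monoidal category with objects the elements of $\mathbb D_V$, morphisms $U\to W$ the cells $(U;I;I;W)$, composition $\mid$, and tensor given by vertical composition. A distributive monoidal category $(\mathbb A,\otimes,\oplus,I)$ is a symmetric monoidal category with binary coproducts $A\oplus B$ (injections $\sigma_0,\sigma_1$, copairing $[f,g]$; no initial object required) such that $[\sigma_0\otimes 1_C,\sigma_1\otimes 1_C]:(A\otimes C)\oplus(B\otimes C)\to(A\oplus B)\otimes C$ is invertible for all $A,B,C$. Exchanges with iteration: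 $\mathbb A^{\circ\bullet}_*$ is the monoid (operation $\otimes$, unit $I$) with elements generated by $A^\circ$, $A^\bullet$ ($A\in\mathbb A_0$), $I$, $U\otimes W$, $U\times W$, $U+W$, $U^\times$, $U^+$, subject to associativity and unitality of $\otimes$ and the equations $U^\times=I\times(U\otimes U^\times)$, $U^+=I+(U\otimes U^+)$. Free cornering with iteration: $\ulcorner\mathbb A\urcorner^{*}$ is the free single-object double category with horizontal edge monoid $(\mathbb A_0,\otimes,I)$, vertical edge monoid $\mathbb A^{\circ\bullet}_*$, and generating cells and equations: (1) for each $f:A\to B$ in $\mathbb A$ a cell $\ulcorner f\urcorner:(I;A;B;I)$ (also written $f$), with $\ulcorner fg\urcorner=\frac{\ulcorner f\urcorner}{\ulcorner g\urcorner}$, $\ulcorner 1_A\urcorner=1_A$, $\ulcorner f\otimes g\urcorner=\ulcorner f\urcorner\mid\ulcorner g\urcorner$; (2) for each $A\in\mathbb A_0$ corner cells $\mathsf{get}_L^A:(A^\circ;I;A;I)$, $\mathsf{put}_R^A:(I;A;I;A^\circ)$, $\mathsf{get}_R^A:(I;I;A;A^\bullet)$, $\mathsf{put}_L^A:(A^\bullet;A;I;I)$ with $\mathsf{put}_R^A\mid\mathsf{get}_L^A=1_A$, $\frac{\mathsf{get}_L^A}{\mathsf{put}_R^A}=id_{A^\circ}$, $\mathsf{get}_R^A\mid\mathsf{put}_L^A=1_A$, $\frac{\mathsf{get}_R^A}{\mathsf{put}_L^A}=id_{A^\bullet}$; (3) for all $U,W$, cells $\pi_0:(U\times W;I;I;U)$,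 $\pi_1:(U\times W;I;I;W)$, and for $\alpha:(V;A;B;U)$, $\beta:(V;A;B;W)$ a unique cell $\alpha\times\beta:(V;A;B;U\times W)$ with $(\alpha\times\beta)\mid\pi_0=\alpha$, $(\alpha\times\beta)\mid\pi_1=\beta$; (4) for all $U,W$, cells $\iota_0:(U;I;I;U+W)$, $\iota_1:(W;I;I;U+W)$, and for $\alpha:(U;A;B;V)$, $\beta:(W;A;B;V)$ a unique cell $\alpha+\beta:(U+W;A;B;V)$ with $\iota_0\mid(\alpha+\beta)=\alpha$, $\iota_1\mid(\alpha+\beta)=\beta$; (5) for $\alpha:(U;A;C;W)$, $\beta:(U;B;C;W)$ a unique cell $[\alpha,\beta]:(U;A\oplus B;C;W)$ with $\frac{\ulcorner\sigma_0\urcorner}{[\alpha,\beta]}=\alpha$, $\frac{\ulcorner\sigma_1\urcorner}{[\alpha,\beta]}=\beta$; (6) for $\alpha:(V;A;A;U)$, $f:(W;A;B;K)$, $g:(W;I;I;V\otimes W)$ a unique cell $\alpha^\times_{f,g}:(W;A;B;U^\times\otimes K)$ with $\alpha^\times_{f,g}\mid\frac{\pi_0}{id_K}=f$ and $\alpha^\times_{f,g}\mid\frac{\pi_1}{id_K}=g\mid\frac{\alpha}{\alpha^\times_{f,g}}$; (7) for $\alpha:(U;A;A;V)$, $f:(K;A;B;W)$, $g:(V\otimes W;I;I;W)$ a unique cell $\alpha^+_{f,g}:(U^+\otimes K;A;B;W)$ with $\frac{\iota_0}{id_K}\mid\alpha^+_{f,g}=f$ and $\frac{\iota_1}{id_K}\mid\alpha^+_{f,g}=\frac{\alpha}{\alpha^+_{f,g}}\mid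 g$. Here $\pi_0:U^\times\to I$, $\pi_1:U^\times\to U\otimes U^\times$, $\iota_0:I\to U^+$, $\iota_1:U\otimes U^+\to U^+$ are the projections/injections of $U^\times=I\times(U\otimes U^\times)$ and $U^+=I+(U\otimes U^+)$. For $\alpha:(U;A;A;W)$ put $\alpha^\times=\alpha^\times_{(\pi_0\mid 1_A),\pi_1}:(U^\times;A;A;W^\times)$ and $\alpha^+=\alpha^+_{(1_A\mid\iota_0),\iota_1}:(U^+;A;A;W^+)$. *)

(* Defs.v *)
From HB Require Import structures.
From mathcomp Require Import all_boot.
From mathcomp Require Import generic_quotient boolp.

Set Implicit Arguments.
Unset Strict Implicit.
Unset Printing Implicit Defensive.

(* Monoids are the library's [monoidType].  It includes a choiceType structure, *)
(* which every type has under the classical axioms of [boolp].                  *)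

Declare Scope cornering_scope.
Delimit Scope cornering_scope with K.
Local Open Scope cornering_scope.

Notation "𝟙" := (one) : cornering_scope.
Notation "x ⊗ y" := (mul x y) (at level 40, left associativity) : cornering_scope.

(* Strictness makes the two sides of many laws live in types whose indices are  *)
(* only propositionally equal.  [heq2] and [heq4] say that the indices agree    *)
(* and that, along this agreement, the elements are equal.                      *)

Inductive heq2 (O : Type) (P : O -> O -> Type) (A B : O) (f : P A B) :
  forall A' B' : O, P A' B' -> Prop :=
| heq2_refl : heq2 f f.

Notation "f ≅ g" := (heq2 f g) (at level 70, no associativity) : cornering_scope.

Definition cast2 (O : Type) (P : O -> O -> Type) (A A' B B' : O)
    (eA : A = A') (eB : B = B') (f : P A B) : P A' B' :=
  match eA in _ = x, eB in _ = y return P x y with erefl, erefl => f end.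

Inductive heq4 (V H : Type) (P : V -> H -> H -> V -> Type)
    (U : V) (A B : H) (W : V) (a : P U A B W) :
  forall (U' : V) (A' B' : H) (W' : V), P U' A' B' W' -> Prop :=
| heq4_refl : heq4 a a.

Notation "a ≋ b" := (heq4 a b) (at level 70, no associativity) : cornering_scope.

Definition cast4 (V H : Type) (P : V -> H -> H -> V -> Type)
    (U U' : V) (A A' B B' : H) (W W' : V)
    (eU : U = U') (eA : A = A') (eB : B = B') (eW : W = W')
    (a : P U A B W) : P U' A' B' W' :=
  match eU in _ = u, eA in _ = x, eB in _ = y, eW in _ = w return P u x y w with
  | erefl, erefl, erefl, erefl => a
  end.

Section Heq4.
Context {V H : Type} {P : V -> H -> H -> V -> Type}.

Lemma heq4_sym U A B W U' A' B' W' (a : P U A B W) (b : P U' A' B' W') :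
  a ≋ b -> b ≋ a.
Proof. by case. Qed.

Lemma heq4_trans U A B W U' A' B' W' U2 A2 B2 W2
    (a : P U A B W) (b : P U' A' B' W') (c : P U2 A2 B2 W2) :
  a ≋ b -> b ≋ c -> a ≋ c.
Proof. by move=> e; case: e c => c. Qed.

Lemma heq4_cast U U' A A' B B' W W' (eU : U = U') (eA : A = A') (eB : B = B')
    (eW : W = W') (a : P U A B W) : cast4 eU eA eB eW a ≋ a.
Proof. by case: _ / eU; case: _ / eA; case: _ / eB; case: _ / eW. Qed.

Lemma heq4P U A B W U' A' B' W' (a : P U A B W) (b : P U' A' B' W') :
  a ≋ b -> exists eU eA eB eW, b = cast4 eU eA eB eW a.
Proof. by case; exists erefl, erefl, erefl, erefl. Qed.

Lemma heq4_eq U A B W (a b : P U A B W) : a ≋ b -> a = b.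
Proof.
move=> e; have [eU [eA [eB [eW ->]]]] := heq4P e.
by rewrite (Prop_irrelevance eU erefl) (Prop_irrelevance eA erefl)
  (Prop_irrelevance eB erefl) (Prop_irrelevance eW erefl).
Qed.

End Heq4.

(* Strict monoidal categories; [compm f g] is first f, then g. *)

Record monCat := MonCat {
  ob :> monoidType;
  hom : ob -> ob -> Type;
  idm : forall A, hom A A;
  compm : forall A B C, hom A B -> hom B C -> hom A C;
  tens : forall A B C D, hom A B -> hom C D -> hom (A ⊗ C) (B ⊗ D);
  comp1m : forall A B (f : hom A B), compm (idm A) f = f;
  compm1 : forall A B (f : hom A B), compm f (idm B) = f;
  compA : forall A B C D (f : hom A B) (g : hom B C) (h : hom C D),
    compm f (compm g h) = compm (compm f g) h;
  tens_id : forall A B, tens (idm A) (idm B) = idm (A ⊗ B);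
  tens_comp : forall A B C A' B' C'
      (f : hom A B) (g : hom B C) (f' : hom A' B') (g' : hom B' C'),
    tens (compm f g) (compm f' g') = compm (tens f f') (tens g g');
  tensA : forall A B C A' B' C' (f : hom A A') (g : hom B B') (h : hom C C'),
    tens f (tens g h) ≅ tens (tens f g) h;
  tens1m : forall A B (f : hom A B), tens (idm 𝟙) f ≅ f;
  tensm1 : forall A B (f : hom A B), tens f (idm 𝟙) ≅ f
}.

Arguments hom {m} A B : rename.
Arguments idm {m} A : rename.
Arguments compm {m A B C} f g : rename.
Arguments tens {m A B C D} f g : rename.

Definition is_comonoid (C : monCat) (X : C) (delta : hom X (X ⊗ X)) (eps : hom X 𝟙)
    : Prop :=
  [/\ compm delta (tens delta (idm X)) ≅ compm delta (tens (idm X) delta),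
      compm delta (tens eps (idm X)) ≅ idm X &
      compm delta (tens (idm X) eps) ≅ idm X].

Definition is_monoid (C : monCat) (X : C) (nabla : hom (X ⊗ X) X) (eta : hom 𝟙 X)
    : Prop :=
  [/\ compm (tens nabla (idm X)) nabla ≅ compm (tens (idm X) nabla) nabla,
      compm (tens eta (idm X)) nabla ≅ idm X &
      compm (tens (idm X) eta) nabla ≅ idm X].

(* Distributive monoidal categories.  In the strict setting the unit coherence  *)
(* of the symmetry follows from [braid_hex] and invertibility.                  *)

Record distMonCat := DistMonCat {
  dmon :> monCat;
  braid : forall A B : dmon, hom (A ⊗ B) (B ⊗ A);
  braid_nat : forall (A B A' B' : dmon) (f : hom A A') (g : hom B B'),
    compm (tens f g) (braid A' B') = compm (braid A B) (tens g f);
  braidK : forall A B : dmon, compm (braid A B) (braid B A) = idm (A ⊗ B);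
  braid_hex : forall A B C : dmon,
    compm (tens (braid A B) (idm C))
         (cast2 (mulgA B A C) erefl (tens (idm B) (braid A C)))
    ≅ braid A (B ⊗ C);
  coprod : dmon -> dmon -> dmon;
  inj0 : forall A B : dmon, hom A (coprod A B);
  inj1 : forall A B : dmon, hom B (coprod A B);
  copair : forall A B C : dmon, hom A C -> hom B C -> hom (coprod A B) C;
  inj0_copair : forall (A B C : dmon) (f : hom A C) (g : hom B C),
    compm (inj0 A B) (copair f g) = f;
  inj1_copair : forall (A B C : dmon) (f : hom A C) (g : hom B C),
    compm (inj1 A B) (copair f g) = g;
  copair_uniq : forall (A B C : dmon) (f : hom A C) (g : hom B C)
      (h : hom (coprod A B) C),
    compm (inj0 A B) h = f -> compm (inj1 A B) h = g -> h = copair f g;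
  distr : forall A B C : dmon,
    let d : hom (coprod (A ⊗ C) (B ⊗ C)) (coprod A B ⊗ C) :=
      copair (tens (inj0 A B) (idm C)) (tens (inj1 A B) (idm C)) in
    exists d', compm d d' = idm _ /\ compm d' d = idm _
}.

Notation "A ⊕ B" := (coprod A B) (at level 50, left associativity)
  : cornering_scope.

(* Single-object double categories.  The boundary of a cell is listed in the    *)
(* order left, top, bottom, right.                                              *)

Reserved Notation "a ∣ b" (at level 48, left associativity).
Reserved Notation "a ⁄ b" (at level 46, left associativity).

Record doubleCat := DoubleCat {
  dH : monoidType;
  dV : monoidType;
  cell : dV -> dH -> dH -> dV -> Type;
  hcomp : forall U A B V A' B' W,
    cell U A B V -> cell V A' B' W -> cell U (A ⊗ A') (B ⊗ B') W;
  vcomp : forall U A C W U' B W',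
    cell U A C W -> cell U' C B W' -> cell (U ⊗ U') A B (W ⊗ W');
  hid : forall U, cell U 𝟙 𝟙 U;
  vid : forall A, cell 𝟙 A A 𝟙;
  hcompA : forall U A B V A' B' W A2 B2 X
      (a : cell U A B V) (b : cell V A' B' W) (c : cell W A2 B2 X),
    hcomp a (hcomp b c) ≋ hcomp (hcomp a b) c;
  hcomp1c : forall U A B W (a : cell U A B W), hcomp (hid U) a ≋ a;
  hcompc1 : forall U A B W (a : cell U A B W), hcomp a (hid W) ≋ a;
  vcompA : forall U A B W U' C W' U2 D W2
      (a : cell U A B W) (b : cell U' B C W') (c : cell U2 C D W2),
    vcomp a (vcomp b c) ≋ vcomp (vcomp a b) c;
  vcomp1c : forall U A B W (a : cell U A B W), vcomp (vid A) a ≋ a;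
  vcompc1 : forall U A B W (a : cell U A B W), vcomp a (vid B) ≋ a;
  hid_vid1 : hid 𝟙 = vid 𝟙;
  vidM : forall A B, vid (A ⊗ B) ≋ hcomp (vid A) (vid B);
  hidM : forall U W, hid (U ⊗ W) ≋ vcomp (hid U) (hid W);
  interchange : forall U A C W U' B W' A' C' X B' X'
      (a : cell U A C W) (b : cell U' C B W')
      (c : cell W A' C' X) (d : cell W' C' B' X'),
    hcomp (vcomp a b) (vcomp c d) = vcomp (hcomp a c) (hcomp b d)
}.

Arguments cell {d} U A B W : rename.
Arguments hcomp {d U A B V A' B' W} a b : rename.
Arguments vcomp {d U A C W U' B W'} a b : rename.
Arguments hid {d} U : rename.
Arguments vid {d} A : rename.

Notation "a ∣ b" := (hcomp a b) : cornering_scope.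
Notation "a ⁄ b" := (vcomp a b) : cornering_scope.

Section HorizontalCells.
Variable D : doubleCat.
Implicit Types U V W : dV D.

Definition hcell U W := cell U (𝟙 : dH D) 𝟙 W.

Definition hcell_comp U V W (a : hcell U V) (b : hcell V W) : hcell U W :=
  cast4 erefl (mul1g 𝟙) (mul1g 𝟙) erefl (a ∣ b).

Definition hcell_tens U W U' W' (a : hcell U W) (b : hcell U' W') :
  hcell (U ⊗ U') (W ⊗ W') := a ⁄ b.

Lemma hcell_compE U V W (a : hcell U V) (b : hcell V W) :
  hcell_comp a b ≋ a ∣ b.
Proof. exact: heq4_cast. Qed.

Lemma heq4_hcomp U A B V A' B' W U1 A1 B1 V1 A1' B1' W1
    (a : cell U A B V) (b : cell V A' B' W)
    (a1 : @cell D U1 A1 B1 V1) (b1 : cell V1 A1' B1' W1) :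
  a ≋ a1 -> b ≋ b1 -> a ∣ b ≋ a1 ∣ b1.
Proof.
move=> ea eb; have [eU [eA [eB [eV ->]]]] := heq4P ea.
have [eV' [eA' [eB' [eW ->]]]] := heq4P eb; subst.
rewrite (Prop_irrelevance eV' erefl); exact: heq4_refl.
Qed.

Lemma heq4_vcomp U A C W U' B W' U1 A1 C1 W1 U1' B1 W1'
    (a : cell U A C W) (b : cell U' C B W')
    (a1 : @cell D U1 A1 C1 W1) (b1 : cell U1' C1 B1 W1') :
  a ≋ a1 -> b ≋ b1 -> a ⁄ b ≋ a1 ⁄ b1.
Proof.
move=> ea eb; have [eU [eA [eC [eW ->]]]] := heq4P ea.
have [eU' [eC' [eB [eW' ->]]]] := heq4P eb; subst.
rewrite (Prop_irrelevance eC' erefl); exact: heq4_refl.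
Qed.

Lemma heq4_heq2 U W U' W' (a : hcell U W) (b : hcell U' W') :
  a ≋ b -> heq2 (P := hcell) a b.
Proof.
move=> e; have [eU [eA [eB [eW ->]]]] := heq4P e; subst.
rewrite (Prop_irrelevance eA erefl) (Prop_irrelevance eB erefl).
exact: heq2_refl.
Qed.

Lemma hcell_comp1m U W (a : hcell U W) : hcell_comp (hid U) a = a.
Proof.
by apply: heq4_eq; apply: heq4_trans (hcell_compE _ _) (hcomp1c _).
Qed.

Lemma hcell_compm1 U W (a : hcell U W) : hcell_comp a (hid W) = a.
Proof.
by apply: heq4_eq; apply: heq4_trans (hcell_compE _ _) (hcompc1 _).
Qed.

Lemma hcell_compA U V W X (a : hcell U V) (b : hcell V W) (c : hcell W X) :
  hcell_comp a (hcell_comp b c) = hcell_comp (hcell_comp a b) c.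
Proof.
apply: heq4_eq; apply: heq4_trans (hcell_compE _ _) _.
apply: heq4_trans (heq4_hcomp (heq4_refl a) (hcell_compE _ _)) _.
apply: heq4_trans (hcompA _ _ _) _; apply: heq4_sym.
apply: heq4_trans (hcell_compE _ _) _.
exact: heq4_hcomp (hcell_compE _ _) (heq4_refl c).
Qed.

Lemma hcell_tens_id U W : hcell_tens (hid U) (hid W) = hid (U ⊗ W).
Proof. exact/heq4_eq/heq4_sym/hidM. Qed.

Lemma hcell_tens_comp U V W U' V' W'
    (a : hcell U V) (b : hcell V W) (a' : hcell U' V') (b' : hcell V' W') :
  hcell_tens (hcell_comp a b) (hcell_comp a' b') =
  hcell_comp (hcell_tens a a') (hcell_tens b b').
Proof.
apply: heq4_eq.
apply: heq4_trans (heq4_vcomp (hcell_compE _ _) (hcell_compE _ _)) _.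
apply: heq4_sym; apply: heq4_trans (hcell_compE _ _) _.
rewrite /hcell_tens interchange; exact: heq4_refl.
Qed.

Lemma hcell_tensA U V W U' V' W'
    (a : hcell U U') (b : hcell V V') (c : hcell W W') :
  heq2 (P := hcell) (hcell_tens a (hcell_tens b c)) (hcell_tens (hcell_tens a b) c).
Proof. exact/heq4_heq2/vcompA. Qed.

Lemma hcell_tens1m U W (a : hcell U W) : heq2 (P := hcell) (hcell_tens (hid 𝟙) a) a.
Proof. by apply: heq4_heq2; rewrite /hcell_tens hid_vid1; exact: vcomp1c. Qed.

Lemma hcell_tensm1 U W (a : hcell U W) : heq2 (P := hcell) (hcell_tens a (hid 𝟙)) a.
Proof. by apply: heq4_heq2; rewrite /hcell_tens hid_vid1; exact: vcompc1. Qed.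

Definition horiz : monCat :=
  MonCat hcell_comp1m hcell_compm1 hcell_compA hcell_tens_id hcell_tens_comp
    hcell_tensA hcell_tens1m hcell_tensm1.

End HorizontalCells.

(* [EOut A] is A°, [EIn A] is A•; [exch O] below is the quotient monoid. *)

Inductive exchTerm (O : Type) : Type :=
| EOut of O
| EIn of O
| EOne
| ETens of exchTerm O & exchTerm O
| EProd of exchTerm O & exchTerm O
| ESum of exchTerm O & exchTerm O
| ETimes of exchTerm O
| EPlus of exchTerm O.

Arguments EOne {O}.

Inductive exchEq (O : Type) : exchTerm O -> exchTerm O -> Prop :=
| EqRefl u : exchEq u u
| EqSym u w : exchEq u w -> exchEq w u
| EqTrans u v w : exchEq u v -> exchEq v w -> exchEq u w
| EqTens u u' w w' : exchEq u u' -> exchEq w w' -> exchEq (ETens u w) (ETens u' w')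
| EqProd u u' w w' : exchEq u u' -> exchEq w w' -> exchEq (EProd u w) (EProd u' w')
| EqSum u u' w w' : exchEq u u' -> exchEq w w' -> exchEq (ESum u w) (ESum u' w')
| EqTimes u u' : exchEq u u' -> exchEq (ETimes u) (ETimes u')
| EqPlus u u' : exchEq u u' -> exchEq (EPlus u) (EPlus u')
| EqTensA u v w : exchEq (ETens u (ETens v w)) (ETens (ETens u v) w)
| EqTens1e u : exchEq (ETens EOne u) u
| EqTense1 u : exchEq (ETens u EOne) u
| EqTimesE u : exchEq (ETimes u) (EProd EOne (ETens u (ETimes u)))
| EqPlusE u : exchEq (EPlus u) (ESum EOne (ETens u (EPlus u))).

Local Open Scope quotient_scope.

Section Exchanges.
Variable O : Type.

Definition exch_rel (u w : {classic exchTerm O}) : bool := `[< exchEq u w >].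

Lemma exch_rel_refl : reflexive exch_rel.
Proof. by move=> u; apply/asboolP/EqRefl. Qed.

Lemma exch_rel_sym : symmetric exch_rel.
Proof. by move=> u w; apply/asboolP/asboolP; apply: EqSym. Qed.

Lemma exch_rel_trans : transitive exch_rel.
Proof. by move=> v u w /asboolP uv /asboolP vw; apply/asboolP/(EqTrans uv). Qed.

Canonical exch_equiv := EquivRel exch_rel exch_rel_refl exch_rel_sym exch_rel_trans.

Definition exch := {eq_quot exch_equiv}.

HB.instance Definition _ := Choice.on exch.

Definition exch_pi (u : exchTerm O) : exch := \pi_exch%qT (u : {classic exchTerm O}).
Definition exch_repr (U : exch) : exchTerm O := repr U.

Lemma exch_piP u w : exch_pi u = exch_pi w <-> exchEq u w.
Proof.
by split=> [/eqmodP/asboolP|uw] //; apply/eqmodP/asboolP.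
Qed.

Lemma exch_reprK U : exch_pi (exch_repr U) = U.
Proof. exact: reprK. Qed.

Definition ex_out (A : O) : exch := exch_pi (EOut A).
Definition ex_in (A : O) : exch := exch_pi (EIn A).
Definition ex_one : exch := exch_pi EOne.
Definition ex_tens (U W : exch) : exch := exch_pi (ETens (exch_repr U) (exch_repr W)).
Definition ex_prod (U W : exch) : exch := exch_pi (EProd (exch_repr U) (exch_repr W)).
Definition ex_sum (U W : exch) : exch := exch_pi (ESum (exch_repr U) (exch_repr W)).
Definition ex_times (U : exch) : exch := exch_pi (ETimes (exch_repr U)).
Definition ex_plus (U : exch) : exch := exch_pi (EPlus (exch_repr U)).

Lemma exch_repr_pi u : exchEq (exch_repr (exch_pi u)) u.
Proof. by apply/exch_piP; rewrite exch_reprK. Qed.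

Lemma ex_tensA : associative ex_tens.
Proof.
move=> U V W; apply/exch_piP.
apply: EqTrans (EqTens (EqRefl _) (exch_repr_pi _)) _.
apply: EqTrans (EqTensA _ _ _) _.
exact: EqTens (EqSym (exch_repr_pi _)) (EqRefl _).
Qed.

Lemma ex_tens1e : left_id ex_one ex_tens.
Proof.
move=> U; rewrite -[RHS]exch_reprK; apply/exch_piP.
exact: EqTrans (EqTens (exch_repr_pi _) (EqRefl _)) (EqTens1e _).
Qed.

Lemma ex_tense1 : right_id ex_one ex_tens.
Proof.
move=> U; rewrite -[RHS]exch_reprK; apply/exch_piP.
exact: EqTrans (EqTens (EqRefl _) (exch_repr_pi _)) (EqTense1 _).
Qed.

HB.instance Definition _ := isMonoid.Build exch ex_tensA ex_tens1e ex_tense1.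

Lemma ex_timesE (U : exch) : ex_times U = ex_prod 𝟙 (U ⊗ ex_times U).
Proof.
apply/exch_piP; apply: EqTrans (EqTimesE _) _.
apply: EqProd; first exact: EqSym (exch_repr_pi _).
apply: EqSym; apply: EqTrans (exch_repr_pi _) _.
exact: EqTens (EqRefl _) (exch_repr_pi _).
Qed.

Lemma ex_plusE (U : exch) : ex_plus U = ex_sum 𝟙 (U ⊗ ex_plus U).
Proof.
apply/exch_piP; apply: EqTrans (EqPlusE _) _.
apply: EqSum; first exact: EqSym (exch_repr_pi _).
apply: EqSym; apply: EqTrans (exch_repr_pi _) _.
exact: EqTens (EqRefl _) (exch_repr_pi _).
Qed.

End Exchanges.


(* The cells of the free double category are these terms modulo [termEq], the   *)
(* least congruence containing the defining equations and closed under the      *)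
(* uniqueness clauses.  [termEq] relates terms with different indices, which    *)
(* are then equal boundaries ([termEq_bound]).                                  *)

Section Terms.
Variable C : distMonCat.
Notation O := (ob C).
Notation E := (exch O).
Implicit Types (U V W X K : E) (A B : C).

Inductive term : E -> O -> O -> E -> Type :=
| THcomp U A B V A' B' W of
    term U A B V & term V A' B' W : term U (A ⊗ A') (B ⊗ B') W
| TVcomp U A B W U' B' W' of
    term U A B W & term U' B B' W' : term (U ⊗ U') A B' (W ⊗ W')
| THid U : term U 𝟙 𝟙 U
| TVid A : term 𝟙 A A 𝟙
| TArr A B of hom A B : term 𝟙 A B 𝟙
| TGetL A : term (ex_out A) 𝟙 A 𝟙
| TPutR A : term 𝟙 A 𝟙 (ex_out A)
| TGetR A : term 𝟙 𝟙 A (ex_in A)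
| TPutL A : term (ex_in A) A 𝟙 𝟙
| TProj0 U W : term (ex_prod U W) 𝟙 𝟙 U
| TProj1 U W : term (ex_prod U W) 𝟙 𝟙 W
| TPair V A B U W of term V A B U & term V A B W : term V A B (ex_prod U W)
| TIn0 U W : term U 𝟙 𝟙 (ex_sum U W)
| TIn1 U W : term W 𝟙 𝟙 (ex_sum U W)
| TCase U W A B V of term U A B V & term W A B V : term (ex_sum U W) A B V
| TCopair U A B B' W of term U A B' W & term U B B' W : term U (A ⊕ B) B' W
| TTimes V A U W B K of
    term V A A U & term W A B K & term W 𝟙 𝟙 (V ⊗ W) :
    term W A B (ex_times U ⊗ K)
| TPlus U A V K B W of
    term U A A V & term K A B W & term (V ⊗ W) 𝟙 𝟙 W :
    term (ex_plus U ⊗ K) A B W.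

Definition TTimesPi0 U : term (ex_times U) 𝟙 𝟙 𝟙 :=
  cast4 (esym (ex_timesE U)) erefl erefl erefl (TProj0 𝟙 (U ⊗ ex_times U)).
Definition TTimesPi1 U : term (ex_times U) 𝟙 𝟙 (U ⊗ ex_times U) :=
  cast4 (esym (ex_timesE U)) erefl erefl erefl (TProj1 𝟙 (U ⊗ ex_times U)).
Definition TPlusIota0 U : term 𝟙 𝟙 𝟙 (ex_plus U) :=
  cast4 erefl erefl erefl (esym (ex_plusE U)) (TIn0 𝟙 (U ⊗ ex_plus U)).
Definition TPlusIota1 U : term (U ⊗ ex_plus U) 𝟙 𝟙 (ex_plus U) :=
  cast4 erefl erefl erefl (esym (ex_plusE U)) (TIn1 𝟙 (U ⊗ ex_plus U)).

Declare Scope term_scope.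
Local Open Scope term_scope.
Local Notation "a ∣ b" := (THcomp a b) : term_scope.
Local Notation "a ⁄ b" := (TVcomp a b) : term_scope.

Reserved Notation "a ≈ b" (at level 70, no associativity).

(* Each operation with a "unique cell" specification contributes its defining   *)
(* equations and a uniqueness clause (the [Uniq] constructors).                 *)

Inductive termEq : forall U A B W, term U A B W ->
    forall U' A' B' W', term U' A' B' W' -> Prop :=
| TeRefl U A B W (a : term U A B W) : a ≈ a
| TeSym U A B W U' A' B' W' (a : term U A B W) (b : term U' A' B' W') :
    a ≈ b -> b ≈ a
| TeTrans U A B W U' A' B' W' U2 A2 B2 W2
    (a : term U A B W) (b : term U' A' B' W') (c : term U2 A2 B2 W2) :
    a ≈ b -> b ≈ c -> a ≈ c
| TeHcomp U A B V A' B' W U1 A1 B1 V1 A1' B1' W1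
    (a : term U A B V) (b : term V A' B' W)
    (a1 : term U1 A1 B1 V1) (b1 : term V1 A1' B1' W1) :
    a ≈ a1 -> b ≈ b1 -> a ∣ b ≈ a1 ∣ b1
| TeVcomp U A B W U' B' W' U1 A1 B1 W1 U1' B1' W1'
    (a : term U A B W) (b : term U' B B' W')
    (a1 : term U1 A1 B1 W1) (b1 : term U1' B1 B1' W1') :
    a ≈ a1 -> b ≈ b1 -> a ⁄ b ≈ a1 ⁄ b1
| TePair V A B U W V1 A1 B1 U1 W1
    (a : term V A B U) (b : term V A B W)
    (a1 : term V1 A1 B1 U1) (b1 : term V1 A1 B1 W1) :
    a ≈ a1 -> b ≈ b1 -> TPair a b ≈ TPair a1 b1
| TeCase U W A B V U1 W1 A1 B1 V1
    (a : term U A B V) (b : term W A B V)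
    (a1 : term U1 A1 B1 V1) (b1 : term W1 A1 B1 V1) :
    a ≈ a1 -> b ≈ b1 -> TCase a b ≈ TCase a1 b1
| TeCopair U A B B' W U1 A1 B1 B1' W1
    (a : term U A B' W) (b : term U B B' W)
    (a1 : term U1 A1 B1' W1) (b1 : term U1 B1 B1' W1) :
    a ≈ a1 -> b ≈ b1 -> TCopair a b ≈ TCopair a1 b1
| TeTimes V A U W B K V1 A1 U1 W1 B1 K1
    (a : term V A A U) (f : term W A B K) (g : term W 𝟙 𝟙 (V ⊗ W))
    (a1 : term V1 A1 A1 U1) (f1 : term W1 A1 B1 K1)
    (g1 : term W1 𝟙 𝟙 (V1 ⊗ W1)) :
    a ≈ a1 -> f ≈ f1 -> g ≈ g1 -> TTimes a f g ≈ TTimes a1 f1 g1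
| TePlus U A V K B W U1 A1 V1 K1 B1 W1
    (a : term U A A V) (f : term K A B W) (g : term (V ⊗ W) 𝟙 𝟙 W)
    (a1 : term U1 A1 A1 V1) (f1 : term K1 A1 B1 W1)
    (g1 : term (V1 ⊗ W1) 𝟙 𝟙 W1) :
    a ≈ a1 -> f ≈ f1 -> g ≈ g1 -> TPlus a f g ≈ TPlus a1 f1 g1
| TeHcompA U A B V A' B' W A2 B2 X
    (a : term U A B V) (b : term V A' B' W) (c : term W A2 B2 X) :
    a ∣ (b ∣ c) ≈ a ∣ b ∣ c
| TeHcomp1c U A B W (a : term U A B W) : THid U ∣ a ≈ a
| TeHcompc1 U A B W (a : term U A B W) : a ∣ THid W ≈ a
| TeVcompA U A B W U' B' W' U2 B2 W2
    (a : term U A B W) (b : term U' B B' W') (c : term U2 B' B2 W2) :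
    a ⁄ (b ⁄ c) ≈ a ⁄ b ⁄ c
| TeVcomp1c U A B W (a : term U A B W) : TVid A ⁄ a ≈ a
| TeVcompc1 U A B W (a : term U A B W) : a ⁄ TVid B ≈ a
| TeHidVid1 : THid 𝟙 ≈ TVid 𝟙
| TeVidM A B : TVid (A ⊗ B) ≈ TVid A ∣ TVid B
| TeHidM U W : THid (U ⊗ W) ≈ THid U ⁄ THid W
| TeInterchange U A B W U' B' W' A1 B1 X B1' X'
    (a : term U A B W) (b : term U' B B' W')
    (c : term W A1 B1 X) (d : term W' B1 B1' X') :
    (a ⁄ b) ∣ (c ⁄ d) ≈ (a ∣ c) ⁄ (b ∣ d)
| TeArrComp (A B B' : C) (f : hom A B) (g : hom B B') :
    TArr (compm f g) ≈ TArr f ⁄ TArr g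
| TeArrId A : TArr (idm A) ≈ TVid A
| TeArrTens (A B A' B' : C) (f : hom A B) (g : hom A' B') :
    TArr (tens f g) ≈ TArr f ∣ TArr g
| TePutRGetL A : TPutR A ∣ TGetL A ≈ TVid A
| TeGetLOverPutR A : TGetL A ⁄ TPutR A ≈ THid (ex_out A)
| TeGetRPutL A : TGetR A ∣ TPutL A ≈ TVid A
| TeGetROverPutL A : TGetR A ⁄ TPutL A ≈ THid (ex_in A)
| TePairProj0 V A B U W (a : term V A B U) (b : term V A B W) :
    TPair a b ∣ TProj0 U W ≈ a
| TePairProj1 V A B U W (a : term V A B U) (b : term V A B W) :
    TPair a b ∣ TProj1 U W ≈ b
| TePairUniq V A B U W (a : term V A B U) (b : term V A B W)
    (c : term V A B (ex_prod U W)) :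
    c ∣ TProj0 U W ≈ a -> c ∣ TProj1 U W ≈ b -> c ≈ TPair a b
| TeIn0Case U W A B V (a : term U A B V) (b : term W A B V) :
    TIn0 U W ∣ TCase a b ≈ a
| TeIn1Case U W A B V (a : term U A B V) (b : term W A B V) :
    TIn1 U W ∣ TCase a b ≈ b
| TeCaseUniq U W A B V (a : term U A B V) (b : term W A B V)
    (c : term (ex_sum U W) A B V) :
    TIn0 U W ∣ c ≈ a -> TIn1 U W ∣ c ≈ b -> c ≈ TCase a b
| TeInj0Copair U A B B' W (a : term U A B' W) (b : term U B B' W) :
    TArr (inj0 A B) ⁄ TCopair a b ≈ a
| TeInj1Copair U A B B' W (a : term U A B' W) (b : term U B B' W) :
    TArr (inj1 A B) ⁄ TCopair a b ≈ b
| TeCopairUniq U A B B' W (a : term U A B' W) (b : term U B B' W)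
    (c : term U (A ⊕ B) B' W) :
    TArr (inj0 A B) ⁄ c ≈ a -> TArr (inj1 A B) ⁄ c ≈ b -> c ≈ TCopair a b
| TeTimesPi0 V A U W B K
    (a : term V A A U) (f : term W A B K) (g : term W 𝟙 𝟙 (V ⊗ W)) :
    TTimes a f g ∣ (TTimesPi0 U ⁄ THid K) ≈ f
| TeTimesPi1 V A U W B K
    (a : term V A A U) (f : term W A B K) (g : term W 𝟙 𝟙 (V ⊗ W)) :
    TTimes a f g ∣ (TTimesPi1 U ⁄ THid K) ≈ g ∣ (a ⁄ TTimes a f g)
| TeTimesUniq V A U W B K
    (a : term V A A U) (f : term W A B K) (g : term W 𝟙 𝟙 (V ⊗ W))
    (c : term W A B (ex_times U ⊗ K)) :
    c ∣ (TTimesPi0 U ⁄ THid K) ≈ f -> c ∣ (TTimesPi1 U ⁄ THid K) ≈ g ∣ (a ⁄ c) ->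
    c ≈ TTimes a f g
| TeIota0Plus U A V K B W
    (a : term U A A V) (f : term K A B W) (g : term (V ⊗ W) 𝟙 𝟙 W) :
    (TPlusIota0 U ⁄ THid K) ∣ TPlus a f g ≈ f
| TeIota1Plus U A V K B W
    (a : term U A A V) (f : term K A B W) (g : term (V ⊗ W) 𝟙 𝟙 W) :
    (TPlusIota1 U ⁄ THid K) ∣ TPlus a f g ≈ (a ⁄ TPlus a f g) ∣ g
| TePlusUniq U A V K B W
    (a : term U A A V) (f : term K A B W) (g : term (V ⊗ W) 𝟙 𝟙 W)
    (c : term (ex_plus U ⊗ K) A B W) :
    (TPlusIota0 U ⁄ THid K) ∣ c ≈ f -> (TPlusIota1 U ⁄ THid K) ∣ c ≈ (a ⁄ c) ∣ g ->
    c ≈ TPlus a f g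
where "a ≈ b" := (termEq a b) : term_scope.

Lemma termEq_bound U A B W (a : term U A B W) U' A' B' W' (b : term U' A' B' W') :
  a ≈ b -> [/\ U = U', A = A', B = B' & W = W'].
Proof.
by elim=> *; repeat match goal with H : and4 _ _ _ _ |- _ => case: H => * end;
  subst; split; rewrite ?mulgA ?mul1g ?mulg1.
Qed.

Lemma term_cast U U' A A' B B' W W' (eU : U = U') (eA : A = A') (eB : B = B')
    (eW : W = W') (a : term U A B W) : cast4 eU eA eB eW a ≈ a.
Proof.
by case: _ / eU; case: _ / eA; case: _ / eB; case: _ / eW; apply: TeRefl.
Qed.

Section CellQuotient.
Variables (U : E) (A B : C) (W : E).

Definition term_rel (a b : {classic term U A B W}) : bool := `[< a ≈ b >].

Lemma term_rel_refl : reflexive term_rel.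
Proof. by move=> a; apply/asboolP/TeRefl. Qed.

Lemma term_rel_sym : symmetric term_rel.
Proof. by move=> a b; apply/asboolP/asboolP; apply: TeSym. Qed.

Lemma term_rel_trans : transitive term_rel.
Proof. by move=> b a c /asboolP ab /asboolP bc; apply/asboolP/(TeTrans ab). Qed.

Canonical term_equiv := EquivRel term_rel term_rel_refl term_rel_sym term_rel_trans.

Definition fcell := {eq_quot term_equiv}.
Definition fpi (a : term U A B W) : fcell := \pi_fcell (a : {classic term U A B W}).
Definition frepr (a : fcell) : term U A B W := repr a.

Lemma fpi_eq a b : fpi a = fpi b <-> a ≈ b.
Proof. by split=> [/eqmodP/asboolP|ab] //; apply/eqmodP/asboolP. Qed.

Lemma freprK a : fpi (frepr a) = a.
Proof. exact: reprK. Qed.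

Lemma frepr_pi a : frepr (fpi a) ≈ a.
Proof. by apply/fpi_eq; rewrite freprK. Qed.

End CellQuotient.

Lemma fpi_heq U A B W (a : term U A B W) U' A' B' W' (b : term U' A' B' W') :
  a ≈ b -> fpi a ≋ fpi b.
Proof.
move=> ab; have [eU eA eB eW] := termEq_bound ab; subst.
by rewrite (proj2 (fpi_eq a b) ab); apply: heq4_refl.
Qed.

Lemma frepr_heq U A B W (a : fcell U A B W) U' A' B' W' (b : term U' A' B' W') :
  frepr a ≈ b -> a ≋ fpi b.
Proof. by move=> ab; rewrite -[a]freprK; apply: fpi_heq. Qed.

Definition fhcomp U A B V A' B' W (a : fcell U A B V) (b : fcell V A' B' W) :
  fcell U (A ⊗ A') (B ⊗ B') W := fpi (frepr a ∣ frepr b).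
Definition fvcomp U A B W U' B' W' (a : fcell U A B W) (b : fcell U' B B' W') :
  fcell (U ⊗ U') A B' (W ⊗ W') := fpi (frepr a ⁄ frepr b).
Definition fhid U : fcell U 𝟙 𝟙 U := fpi (THid U).
Definition fvid A : fcell 𝟙 A A 𝟙 := fpi (TVid A).

Lemma fhcompA U A B V A' B' W A2 B2 X
    (a : fcell U A B V) (b : fcell V A' B' W) (c : fcell W A2 B2 X) :
  fhcomp a (fhcomp b c) ≋ fhcomp (fhcomp a b) c.
Proof.
apply: fpi_heq; apply: TeTrans (TeHcomp (TeRefl _) (frepr_pi _)) _.
apply: TeTrans (TeHcompA _ _ _) _.
exact: TeHcomp (TeSym (frepr_pi _)) (TeRefl _).
Qed.

Lemma fhcomp1c U A B W (a : fcell U A B W) : fhcomp (fhid U) a ≋ a.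
Proof.
apply/heq4_sym/frepr_heq/TeSym.
exact: TeTrans (TeHcomp (frepr_pi _) (TeRefl _)) (TeHcomp1c _).
Qed.

Lemma fhcompc1 U A B W (a : fcell U A B W) : fhcomp a (fhid W) ≋ a.
Proof.
apply/heq4_sym/frepr_heq/TeSym.
exact: TeTrans (TeHcomp (TeRefl _) (frepr_pi _)) (TeHcompc1 _).
Qed.

Lemma fvcompA U A B W U' B' W' U2 B2 W2
    (a : fcell U A B W) (b : fcell U' B B' W') (c : fcell U2 B' B2 W2) :
  fvcomp a (fvcomp b c) ≋ fvcomp (fvcomp a b) c.
Proof.
apply: fpi_heq; apply: TeTrans (TeVcomp (TeRefl _) (frepr_pi _)) _.
apply: TeTrans (TeVcompA _ _ _) _.
exact: TeVcomp (TeSym (frepr_pi _)) (TeRefl _).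
Qed.

Lemma fvcomp1c U A B W (a : fcell U A B W) : fvcomp (fvid A) a ≋ a.
Proof.
apply/heq4_sym/frepr_heq/TeSym.
exact: TeTrans (TeVcomp (frepr_pi _) (TeRefl _)) (TeVcomp1c _).
Qed.

Lemma fvcompc1 U A B W (a : fcell U A B W) : fvcomp a (fvid B) ≋ a.
Proof.
apply/heq4_sym/frepr_heq/TeSym.
exact: TeTrans (TeVcomp (TeRefl _) (frepr_pi _)) (TeVcompc1 _).
Qed.

Lemma fhid_vid1 : fhid 𝟙 = fvid 𝟙.
Proof. exact/fpi_eq/TeHidVid1. Qed.

Lemma fvidM A B : fvid (A ⊗ B) ≋ fhcomp (fvid A) (fvid B).
Proof.
apply: fpi_heq; apply: TeTrans (TeVidM _ _) _.
exact: TeHcomp (TeSym (frepr_pi _)) (TeSym (frepr_pi _)).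
Qed.

Lemma fhidM U W : fhid (U ⊗ W) ≋ fvcomp (fhid U) (fhid W).
Proof.
apply: fpi_heq; apply: TeTrans (TeHidM _ _) _.
exact: TeVcomp (TeSym (frepr_pi _)) (TeSym (frepr_pi _)).
Qed.

Lemma finterchange U A B W U' B' W' A1 B1 X B1' X'
    (a : fcell U A B W) (b : fcell U' B B' W')
    (c : fcell W A1 B1 X) (d : fcell W' B1 B1' X') :
  fhcomp (fvcomp a b) (fvcomp c d) = fvcomp (fhcomp a c) (fhcomp b d).
Proof.
apply/fpi_eq; apply: TeTrans (TeHcomp (frepr_pi _) (frepr_pi _)) _.
apply: TeTrans (TeInterchange _ _ _ _) _.
exact: TeVcomp (TeSym (frepr_pi _)) (TeSym (frepr_pi _)).
Qed.

Definition cornering : doubleCat :=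
  DoubleCat fhcompA fhcomp1c fhcompc1 fvcompA fvcomp1c fvcompc1
    fhid_vid1 fvidM fhidM finterchange.

End Terms.

Section Iteration.
Variable C : distMonCat.
Notation D := (cornering C).
Implicit Types (U V W K : dV D) (A B : dH D).

Definition times_pi0 U : @cell D (ex_times U) 𝟙 𝟙 𝟙 := fpi (TTimesPi0 U).
Definition times_pi1 U : @cell D (ex_times U) 𝟙 𝟙 (U ⊗ ex_times U) := fpi (TTimesPi1 U).
Definition plus_iota0 U : @cell D 𝟙 𝟙 𝟙 (ex_plus U) := fpi (TPlusIota0 U).
Definition plus_iota1 U : @cell D (U ⊗ ex_plus U) 𝟙 𝟙 (ex_plus U) := fpi (TPlusIota1 U).

Definition times_rec V A U W B K (a : @cell D V A A U) (f : @cell D W A B K)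
    (g : @cell D W 𝟙 𝟙 (V ⊗ W)) : @cell D W A B (ex_times U ⊗ K) :=
  fpi (TTimes (frepr a) (frepr f) (frepr g)).

Definition plus_rec U A V K B W (a : @cell D U A A V) (f : @cell D K A B W)
    (g : @cell D (V ⊗ W) 𝟙 𝟙 W) : @cell D (ex_plus U ⊗ K) A B W :=
  fpi (TPlus (frepr a) (frepr f) (frepr g)).

(* The casts only use the unit laws of the edge monoids. *)

Definition cell_times U A W (a : @cell D U A A W) : @cell D (ex_times U) A A (ex_times W) :=
  cast4 erefl erefl erefl (mulg1 (ex_times W))
    (times_rec a (cast4 erefl (mul1g A) (mul1g A) erefl (times_pi0 U ∣ vid A)) (times_pi1 U)).

Definition cell_plus U A W (a : @cell D U A A W) : @cell D (ex_plus U) A A (ex_plus W) :=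
  cast4 (mulg1 (ex_plus U)) erefl erefl erefl
    (plus_rec a (cast4 erefl (mulg1 A) (mulg1 A) erefl (vid A ∣ plus_iota0 W)) (plus_iota1 W)).

Definition hcell_times U W (h : hom (m := horiz D) U W) :
  hom (m := horiz D) (ex_times U) (ex_times W) := cell_times h.

Definition hcell_plus U W (h : hom (m := horiz D) U W) :
  hom (m := horiz D) (ex_plus U) (ex_plus W) := cell_plus h.

Definition times_Delta U : hom (m := horiz D) (ex_times U) (ex_times U ⊗ ex_times U) :=
  times_rec (@hid D U) (@hid D (ex_times U)) (times_pi1 U).

Definition plus_Nabla U : hom (m := horiz D) (ex_plus U ⊗ ex_plus U) (ex_plus U) :=
  plus_rec (@hid D U) (@hid D (ex_plus U)) (plus_iota1 U).

End Iteration.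

(* Main.v *)
(* A map c into U^× ⊗ K is determined by c | (π0/id) together with the equation  *)
(* c | (π1/id) = g | (a/c).  Both sides of each law for U^× are shown to satisfy *)
(* such equations with the same data.  The laws for U^+ are those for U^× in the *)
(* opposite monoidal category.                                                   *)

From mathcomp Require Import ssrfun boolp.
Require Import Defs.
From mathcomp Require Import ssreflect ssrbool monoid.

Set Implicit Arguments.
Unset Strict Implicit.
Unset Printing Implicit Defensive.

Local Open Scope cornering_scope.

(** Each law for U^× compares two solutions of the same corecursive equations. The cell Δ | (id/q)
    has the data (id_U, q, π1) for every q out of U^×. Taking q = Δ gives coassociativity, because Δ
    | (Δ/id) has the same data; taking q = π0 gives the right counit law, because the identity has
    the same data. The left counit law is the base equation of Δ itself. In the naturality square
    both sides have the data (h, h^×, π1).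

    This argument uses only composition and tensor, so [diag_comonoid] and [diag_natural] carry it
    out in any strict monoidal category, from the uniqueness property [corec_unique] and the
    equations of Δ and h^×. [times_corec_unique] and [plus_rec_unique] supply that uniqueness in the
    category of horizontal cells and in its opposite; the second use yields the laws for U^+. *)

Section Heq2.
Context {O : Type} {P : O -> O -> Type}.

Lemma heq2_sym A B A' B' (f : P A B) (g : P A' B') : f ≅ g -> g ≅ f.
Proof. by case. Qed.

Lemma heq2_trans A B A' B' A2 B2 (f : P A B) (g : P A' B') (h : P A2 B2) :
  f ≅ g -> g ≅ h -> f ≅ h.
Proof. by move=> e; case: e h => h. Qed.

Lemma heq2P A B A' B' (f : P A B) (g : P A' B') :
  f ≅ g -> exists eA eB, g = cast2 eA eB f.
Proof. by case; exists erefl, erefl. Qed.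

(** Proof irrelevance makes the casts between equal endpoints trivial. *)
Lemma heq2_eq A B (f g : P A B) : f ≅ g -> f = g.
Proof.
move=> e; have [eA [eB ->]] := heq2P e.
by rewrite (Prop_irrelevance eA erefl) (Prop_irrelevance eB erefl).
Qed.

Lemma eq_heq2 A B (f g : P A B) : f = g -> f ≅ g.
Proof. by move=> ->; exact: heq2_refl. Qed.

Lemma heq2_flip A B A' B' (f : P A B) (g : P A' B') :
  f ≅ g -> heq2 (P := fun A B => P B A) f g.
Proof. by move=> e; have [eA [eB ->]] := heq2P e; subst; exact: heq2_refl. Qed.

End Heq2.

(** * Diagonals from unique corecursion in a strict monoidal category *)

Section MonCat.
Variable C : monCat.
Implicit Types A B U V W K : C.

Lemma heq2_comp A B D A' B' D' (f : hom A B) (g : hom B D)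
    (f' : hom A' B') (g' : hom B' D') :
  f ≅ f' -> g ≅ g' -> compm f g ≅ compm f' g'.
Proof.
move=> ef eg; have [eA [eB ->]] := heq2P ef; have [eB' [eD ->]] := heq2P eg; subst.
by rewrite (Prop_irrelevance eB' erefl); apply: heq2_refl.
Qed.

Lemma heq2_tens A B D E A' B' D' E' (f : hom A B) (g : hom D E)
    (f' : hom A' B') (g' : hom D' E') :
  f ≅ f' -> g ≅ g' -> tens f g ≅ tens f' g'.
Proof.
move=> ef eg; have [eA [eB ->]] := heq2P ef; have [eD [eE ->]] := heq2P eg; subst.
exact: heq2_refl.
Qed.

Lemma tens_interchange A B D E (f : hom A B) (g : hom D E) :
  compm (tens (idm A) g) (tens f (idm E)) = compm (tens f (idm D)) (tens (idm B) g).
Proof. by rewrite -!tens_comp !comp1m !compm1. Qed.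

(** Arrows are reversed but the order of the tensor is kept, so left and right (co)unit laws are not
    swapped. It is transparent, so that its homs and composites compute to those of [C]. *)
Definition opMonCat : monCat.
Proof.
apply: (@MonCat (ob C) (fun A B => hom B A) (@idm C)
  (fun _ _ _ f g => compm g f) (fun _ _ _ _ f g => tens f g)) => *.
- exact: compm1.
- exact: comp1m.
- by rewrite compA.
- exact: tens_id.
- exact: tens_comp.
- exact/heq2_flip/tensA.
- exact/heq2_flip/tens1m.
- exact/heq2_flip/tensm1.
Defined.

(** The uniqueness half of the universal property of U^×, for cells with trivial top and bottom. Its
    parameter [a] is an identity for the comonoid laws and h for naturality. *)
Definition corec_unique U T (p0 : hom T 𝟙) (p1 : hom T (U ⊗ T)) : Prop :=
  forall V W K (a : hom V U) (f : hom W K) (g : hom W (V ⊗ W))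
    (c d : hom W (T ⊗ K)),
  compm c (tens p0 (idm K)) ≅ f ->
  compm c (tens p1 (idm K)) ≅ compm g (tens a c) ->
  compm d (tens p0 (idm K)) ≅ f ->
  compm d (tens p1 (idm K)) ≅ compm g (tens a d) ->
  c = d.

(* The codomains of [c] and [d] may be bracketed differently from [T ⊗ K], hence *)
(* the flexible representatives of the whiskered projections.                    *)
Lemma corec_unique_heq U T (p0 : hom T 𝟙) (p1 : hom T (U ⊗ T))
    V W K (a : hom V U) (f : hom W K) (g : hom W (V ⊗ W))
    Y Y' Z0 Z1 Z0' Z1' (c : hom W Y) (d : hom W Y')
    (x0 : hom Y Z0) (x1 : hom Y Z1) (y0 : hom Y' Z0') (y1 : hom Y' Z1') :
  corec_unique p0 p1 ->
  tens p0 (idm K) ≅ x0 -> tens p1 (idm K) ≅ x1 ->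
  tens p0 (idm K) ≅ y0 -> tens p1 (idm K) ≅ y1 ->
  compm c x0 ≅ f -> compm c x1 ≅ compm g (tens a c) ->
  compm d y0 ≅ f -> compm d y1 ≅ compm g (tens a d) ->
  c ≅ d.
Proof.
move=> uniq hx0 hx1 hy0 hy1.
have [eY [e0 ->]] := heq2P hx0; have [eY1 [e1 ->]] := heq2P hx1.
have [eY' [e0' ->]] := heq2P hy0; have [eY1' [e1' ->]] := heq2P hy1; subst.
(* Each codomain was identified twice, once per projection; the second identification is now a
   loop. *)
rewrite (Prop_irrelevance eY1 erefl) (Prop_irrelevance eY1' erefl) /=.
move=> c0 c1 d0 d1; apply: eq_heq2; exact: uniq c0 c1 d0 d1.
Qed.

Section Diagonal.
Variables (U T : C) (p0 : hom T 𝟙) (p1 : hom T (U ⊗ T)) (delta : hom T (T ⊗ T)).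
Hypothesis uniq : corec_unique p0 p1.
Hypothesis delta0 : compm delta (tens p0 (idm T)) ≅ idm T.
Hypothesis delta1 :
  compm delta (tens p1 (idm T)) ≅ compm p1 (tens (idm U) delta).

(** By interchange q slides past [p0], which leaves the base equation of [delta]. With
    [diag_whisker1], this makes [delta] followed by id ⊗ q the solution with data (id, q, [p1]). *)
Lemma diag_whisker0 X (q : hom T X) :
  compm (compm delta (tens (idm T) q)) (tens p0 (idm X)) ≅ q.
Proof.
rewrite -compA tens_interchange compA -{2}(comp1m q).
exact: heq2_comp delta0 (tens1m q).
Qed.

Lemma diag_whisker1 X (q : hom T X) :
  compm (compm delta (tens (idm T) q)) (tens p1 (idm X)) ≅
    compm p1 (tens (idm U) (compm delta (tens (idm T) q))).
Proof.
rewrite -compA tens_interchange compA -(comp1m (idm U)) tens_comp compA -tens_id.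
apply: heq2_comp delta1 _.
exact/heq2_sym/tensA.
Qed.

Lemma diag_comonoid : is_comonoid delta p0.
Proof.
split=> //.
(* Coassociativity: the left-hand side lands in (T ⊗ T) ⊗ T, while corecursion with K = T ⊗ T lands
   in T ⊗ (T ⊗ T). *)
- have heq_x X (p : hom T X) :
      tens p (idm (T ⊗ T)) ≅ tens (tens p (idm T)) (idm T).
    by rewrite -tens_id; apply: tensA.
  apply: (corec_unique_heq (a := idm U) (f := delta) (g := p1)
    uniq (heq_x _ _) (heq_x _ _)
    (heq2_refl _) (heq2_refl _) _ _ (diag_whisker0 _) (diag_whisker1 _)).
  + rewrite -compA -tens_comp comp1m -{3}(compm1 delta) -tens_id.
    apply: heq2_comp (heq2_refl _) _.
    exact: heq2_tens delta0 (heq2_refl _).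
  + rewrite -compA -tens_comp.
    apply: heq2_trans (heq2_comp (heq2_refl _)
      (heq2_tens delta1 (heq2_refl _))) _.
    rewrite tens_comp compA -{2}(comp1m (idm U)) tens_comp compA.
    apply: heq2_comp delta1 _; exact/heq2_sym/tensA.
(* Right counit: here K is the unit, and the identity of T is the competing solution. *)
- apply: (corec_unique_heq (a := idm U) (f := p0) (g := p1)
    uniq (heq2_refl _) (heq2_refl _) (tensm1 _) (tensm1 _)
    (diag_whisker0 _) (diag_whisker1 _)).
  + by rewrite comp1m; apply: heq2_refl.
  + by rewrite comp1m tens_id compm1; apply: heq2_refl.
Qed.

End Diagonal.

(** Both sides solve the corecursion for [p0'], [p1'] with data ([h], [t], [p1]), where [t] stands
    for h^×. *)
Lemma diag_natural U T (p0 : hom T 𝟙) (p1 : hom T (U ⊗ T)) (delta : hom T (T ⊗ T))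
    U' T' (p0' : hom T' 𝟙) (p1' : hom T' (U' ⊗ T')) (delta' : hom T' (T' ⊗ T'))
    (h : hom U U') (t : hom T T') :
  corec_unique p0' p1' ->
  compm delta (tens p0 (idm T)) ≅ idm T ->
  compm delta (tens p1 (idm T)) ≅ compm p1 (tens (idm U) delta) ->
  compm delta' (tens p0' (idm T')) ≅ idm T' ->
  compm delta' (tens p1' (idm T')) ≅ compm p1' (tens (idm U') delta') ->
  compm t p0' = p0 -> compm t p1' = compm p1 (tens h t) ->
  compm delta (tens t t) = compm t delta'.
Proof.
move=> uniq d0 d1 d0' d1' t0 t1.
apply: (uniq _ _ _ h t p1).
- rewrite -compA -tens_comp t0 compm1 -(compm1 p0) -(comp1m t) tens_comp compA.
  exact: heq2_comp d0 (tens1m _).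
- rewrite -compA -tens_comp t1 compm1 -{2}(comp1m t) tens_comp compA.
  rewrite -{2}(comp1m h) tens_comp compA.
  apply: heq2_comp d1 _; exact/heq2_sym/tensA.
- rewrite -compA -{2}(compm1 t); exact: heq2_comp (heq2_refl _) d0'.
- rewrite -compA; apply: heq2_trans (heq2_comp (heq2_refl _) d1') _.
  rewrite compA t1 -compA -tens_comp compm1; exact: heq2_refl.
Qed.

End MonCat.

Lemma op_comonoid (C : monCat) (X : C) (n : hom (X ⊗ X) X) (e : hom 𝟙 X) :
  @is_comonoid (opMonCat C) X n e -> is_monoid n e.
Proof. by case=> a l r; split; apply: heq2_flip. Qed.

(** * Iteration on horizontal cells of the free cornering *)

Section Cornering.
Variable A : distMonCat.
Notation D := (cornering A).
Notation M := (horiz D).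
Notation "a ≈ b" := (termEq (C := A) a b) (at level 70, no associativity).

Lemma frepr_cast U U' B B' E E' W W' (eU : U = U') (eB : B = B') (eE : E = E')
    (eW : W = W') (a : fcell U B E W) : frepr (cast4 eU eB eE eW a) ≈ frepr a.
Proof. by subst; apply: TeRefl. Qed.

Lemma frepr_comp (U V W : M) (f : hom U V) (g : hom V W) :
  frepr (compm f g) ≈ THcomp (frepr f) (frepr g).
Proof. exact: TeTrans (frepr_cast _ _ _ _ _) (frepr_pi _). Qed.

Lemma frepr_tens (U V W X : M) (f : hom U V) (g : hom W X) :
  frepr (tens f g) ≈ TVcomp (frepr f) (frepr g).
Proof. exact: frepr_pi. Qed.

(** Moves a law to representatives, where [termEq] already ignores casts between boundaries. *)
Lemma hom_heq (U V W X : M) (f : hom U V) (g : hom W X) :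
  f ≅ g <-> frepr f ≈ frepr g.
Proof.
split=> [|e]; first by case; apply: TeRefl.
apply: heq4_heq2; rewrite -[f]freprK -[g]freprK; exact: fpi_heq.
Qed.

Lemma frepr_eq U B B' W (a b : fcell U B B' W) : frepr a ≈ frepr b -> a = b.
Proof. by move=> e; rewrite -[a]freprK -[b]freprK; apply/fpi_eq. Qed.

Lemma times_corec_unique (U : M) :
  @corec_unique M U (ex_times U) (times_pi0 U) (times_pi1 U).
Proof.
have whisk (T T' K W : M) (p : term T 𝟙 𝟙 T') (c : hom W (T ⊗ K)) :
    frepr (compm c (tens (fpi p : hom (m := M) _ _) (idm K))) ≈
    THcomp (frepr c) (TVcomp p (THid K)).
  apply: TeTrans (frepr_comp _ _) (TeHcomp (TeRefl _) _).
  exact: TeTrans (frepr_tens _ _) (TeVcomp (frepr_pi _) (frepr_pi _)).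
move=> V W K a f g c d c0 c1 d0 d1; apply: frepr_eq.
(* Any solution is the syntactic corecursor on representatives, by the uniqueness clause of
   [termEq]. *)
have sol (x : hom W (ex_times U ⊗ K : M)) :
    compm x (tens (times_pi0 U : hom (m := M) _ _) (idm K)) ≅ f ->
    compm x (tens (times_pi1 U : hom (m := M) _ _) (idm K)) ≅ compm g (tens a x) ->
    frepr x ≈ TTimes (frepr a) (frepr f) (frepr g).
  move=> /hom_heq x0 /hom_heq x1; apply: TeTimesUniq.
    exact: TeTrans (TeSym (whisk _ _ _ _ _ _)) x0.
  apply: TeTrans (TeSym (whisk _ _ _ _ _ _)) (TeTrans x1 _).
  exact: TeTrans (frepr_comp _ _) (TeHcomp (TeRefl _) (frepr_tens _ _)).
exact: TeTrans (sol c c0 c1) (TeSym (sol d d0 d1)).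
Qed.

Lemma plus_rec_unique (U : M) :
  @corec_unique (opMonCat M) U (ex_plus U) (plus_iota0 U) (plus_iota1 U).
Proof.
have whisk (T T' K W : M) (p : term T' 𝟙 𝟙 T) (c : hom (T ⊗ K) W) :
    frepr (compm (tens (fpi p : hom (m := M) _ _) (idm K)) c) ≈
    THcomp (TVcomp p (THid K)) (frepr c).
  apply: TeTrans (frepr_comp _ _) (TeHcomp _ (TeRefl _)).
  exact: TeTrans (frepr_tens _ _) (TeVcomp (frepr_pi _) (frepr_pi _)).
have sol (V W K : M) (a : hom U V) (f : hom K W) (g : hom (V ⊗ W) W)
    (x : hom (ex_plus U ⊗ K : M) W) :
    compm (tens (plus_iota0 U : hom (m := M) _ _) (idm K)) x ≅ f ->
    compm (tens (plus_iota1 U : hom (m := M) _ _) (idm K)) x ≅ compm (tens a x) g ->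
    frepr x ≈ TPlus (frepr a) (frepr f) (frepr g).
  move=> /hom_heq x0 /hom_heq x1; apply: TePlusUniq.
    exact: TeTrans (TeSym (whisk _ _ _ _ _ _)) x0.
  apply: TeTrans (TeSym (whisk _ _ _ _ _ _)) (TeTrans x1 _).
  exact: TeTrans (frepr_comp _ _) (TeHcomp (frepr_tens _ _) (TeRefl _)).
move=> V W K a f g c d c0 c1 d0 d1; apply: frepr_eq.
exact: TeTrans (sol _ _ _ _ _ _ c (heq2_flip c0) (heq2_flip c1))
  (TeSym (sol _ _ _ _ _ _ d (heq2_flip d0) (heq2_flip d1))).
Qed.

Lemma times_rec0 (V U W K : M) (a : hom V U) (f : hom W K) (g : hom W (V ⊗ W)) :
  compm (times_rec a f g : hom W (ex_times U ⊗ K : M))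
    (tens (times_pi0 U : hom (m := M) _ _) (idm K)) ≅ f.
Proof.
apply/hom_heq; apply: TeTrans (frepr_comp _ _) _.
apply: TeTrans _ (TeTimesPi0 (frepr a) (frepr f) (frepr g)).
apply: TeHcomp (frepr_pi _) _.
exact: TeTrans (frepr_tens _ _) (TeVcomp (frepr_pi _) (frepr_pi _)).
Qed.

Lemma times_rec1 (V U W K : M) (a : hom V U) (f : hom W K) (g : hom W (V ⊗ W)) :
  compm (times_rec a f g : hom W (ex_times U ⊗ K : M))
    (tens (times_pi1 U : hom (m := M) _ _) (idm K)) ≅
  compm g (tens a (times_rec a f g : hom W (ex_times U ⊗ K : M))).
Proof.
apply/hom_heq; apply: TeTrans (frepr_comp _ _) _.
apply: (@TeTrans _ _ _ _ _ _ _ _ _ _ _ _ _ _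
  (THcomp (TTimes (frepr a) (frepr f) (frepr g)) (TVcomp (TTimesPi1 U) (THid K)))).
  apply: TeHcomp (frepr_pi _) _.
  exact: TeTrans (frepr_tens _ _) (TeVcomp (frepr_pi _) (frepr_pi _)).
apply: TeTrans (TeTimesPi1 _ _ _) _; apply: TeSym.
apply: TeTrans (frepr_comp _ _) (TeHcomp (TeRefl _) _).
exact: TeTrans (frepr_tens _ _) (TeVcomp (TeRefl _) (frepr_pi _)).
Qed.

Lemma plus_rec0 (V U W K : M) (a : hom U V) (f : hom K W) (g : hom (V ⊗ W) W) :
  compm (tens (plus_iota0 U : hom (m := M) _ _) (idm K))
    (plus_rec a f g : hom (ex_plus U ⊗ K : M) W) ≅ f.
Proof.
apply/hom_heq; apply: TeTrans (frepr_comp _ _) _.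
apply: TeTrans _ (TeIota0Plus (frepr a) (frepr f) (frepr g)).
apply: TeHcomp _ (frepr_pi _).
exact: TeTrans (frepr_tens _ _) (TeVcomp (frepr_pi _) (frepr_pi _)).
Qed.

Lemma plus_rec1 (V U W K : M) (a : hom U V) (f : hom K W) (g : hom (V ⊗ W) W) :
  compm (tens (plus_iota1 U : hom (m := M) _ _) (idm K))
    (plus_rec a f g : hom (ex_plus U ⊗ K : M) W) ≅
  compm (tens a (plus_rec a f g : hom (ex_plus U ⊗ K : M) W)) g.
Proof.
apply/hom_heq; apply: TeTrans (frepr_comp _ _) _.
apply: (@TeTrans _ _ _ _ _ _ _ _ _ _ _ _ _ _
  (THcomp (TVcomp (TPlusIota1 U) (THid K)) (TPlus (frepr a) (frepr f) (frepr g)))).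
  apply: TeHcomp _ (frepr_pi _).
  exact: TeTrans (frepr_tens _ _) (TeVcomp (frepr_pi _) (frepr_pi _)).
apply: TeTrans (TeIota1Plus _ _ _) _; apply: TeSym.
apply: TeTrans (frepr_comp _ _) (TeHcomp _ (TeRefl _)).
exact: TeTrans (frepr_tens _ _) (TeVcomp (TeRefl _) (frepr_pi _)).
Qed.

Lemma heq_cast4 (U V W X : M) (f : hom U V) eU e e' eX :
  (cast4 (U' := W) (W' := X) eU e e' eX (f : fcell _ _ _ _) : hom W X) ≅ f.
Proof. by apply/hom_heq/frepr_cast. Qed.

Lemma hcell_times0 (U W : M) (h : hom U W) :
  compm (hcell_times h) (times_pi0 W : hom (m := M) _ _) = times_pi0 U.
Proof.
apply: heq2_eq.
(* h^× is a corecursion with K = I, so π0 is first rewritten as π0/id. *)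
apply: heq2_trans (heq2_comp (heq_cast4 _ _ _ _ _) (heq2_sym (tensm1 _))) _.
apply: heq2_trans (times_rec0 _ _ _) _; apply/hom_heq.
apply: TeTrans (frepr_cast _ _ _ _ _) _.
apply: TeTrans (frepr_pi _) _.
apply: TeTrans (TeHcomp (TeRefl _) (frepr_pi _)) _.
(* The base datum π0 | 1_I is π0, because 1_I = id_I. *)
exact: TeTrans (TeHcomp (TeRefl _) (TeSym (TeHidVid1 _))) (TeHcompc1 _).
Qed.

Lemma hcell_times1 (U W : M) (h : hom U W) :
  compm (hcell_times h) (times_pi1 W : hom (m := M) _ _) =
  compm (times_pi1 U : hom (m := M) _ _) (tens h (hcell_times h)).
Proof.
apply: heq2_eq.
apply: heq2_trans (heq2_comp (heq_cast4 _ _ _ _ _) (heq2_sym (tensm1 _))) _.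
apply: heq2_trans (times_rec1 _ _ _) _.
apply: heq2_comp (heq2_refl _) (heq2_tens (heq2_refl _) _).
exact/heq2_sym/heq_cast4.
Qed.

Lemma hcell_plus0 (U W : M) (h : hom U W) :
  compm (plus_iota0 U : hom (m := M) _ _) (hcell_plus h) = plus_iota0 W.
Proof.
apply: heq2_eq.
apply: heq2_trans (heq2_comp (heq2_sym (tensm1 _)) (heq_cast4 _ _ _ _ _)) _.
apply: heq2_trans (plus_rec0 _ _ _) _; apply/hom_heq.
apply: TeTrans (frepr_cast _ _ _ _ _) _.
apply: TeTrans (frepr_pi _) _.
apply: TeTrans (TeHcomp (frepr_pi _) (TeRefl _)) _.
exact: TeTrans (TeHcomp (TeSym (TeHidVid1 _)) (TeRefl _)) (TeHcomp1c _).
Qed.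

Lemma hcell_plus1 (U W : M) (h : hom U W) :
  compm (plus_iota1 U : hom (m := M) _ _) (hcell_plus h) =
  compm (tens h (hcell_plus h)) (plus_iota1 W : hom (m := M) _ _).
Proof.
apply: heq2_eq.
apply: heq2_trans (heq2_comp (heq2_sym (tensm1 _)) (heq_cast4 _ _ _ _ _)) _.
apply: heq2_trans (plus_rec1 _ _ _) _.
apply: heq2_comp (heq2_tens (heq2_refl _) _) (heq2_refl _).
exact/heq2_sym/heq_cast4.
Qed.

End Cornering.

Theorem lemma18 (A : distMonCat) :
  let M := horiz (cornering A) in
  forall U W : M,
    [/\ is_comonoid (times_Delta U) (times_pi0 U),
        is_monoid (plus_Nabla U) (plus_iota0 U) &
        forall h : hom U W,
          compm (times_Delta U) (tens (hcell_times h) (hcell_times h)) =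
            compm (hcell_times h) (times_Delta W) /\
          compm (plus_Nabla U) (hcell_plus h) =
            compm (tens (hcell_plus h) (hcell_plus h)) (plus_Nabla W)].
Proof.
move=> M U W.
have delta0 V := @times_rec0 A V V _ _ (idm V) (idm _) (times_pi1 V).
have delta1 V := @times_rec1 A V V _ _ (idm V) (idm _) (times_pi1 V).
have nabla0 V := heq2_flip (@plus_rec0 A V V _ _ (idm V) (idm _) (plus_iota1 V)).
have nabla1 V := heq2_flip (@plus_rec1 A V V _ _ (idm V) (idm _) (plus_iota1 V)).
split.
- exact: diag_comonoid (@times_corec_unique A U) (delta0 U) (delta1 U).
- apply: op_comonoid.
  exact: diag_comonoid (@plus_rec_unique A U) (nabla0 U) (nabla1 U).
move=> h; split.
- exact: diag_natural (@times_corec_unique A W) (delta0 U) (delta1 U)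
    (delta0 W) (delta1 W) (hcell_times0 h) (hcell_times1 h).
(* In the opposite category h runs from W to U, so the roles of U and W and the two sides are
   exchanged. *)
- symmetry.
  exact: (@diag_natural (opMonCat M)) (@plus_rec_unique A U) (nabla0 W) (nabla1 W)
    (nabla0 U) (nabla1 U) (hcell_plus0 h) (hcell_plus1 h).
Qed.
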